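(* Let $(M^{2n},\omega,\mathbb T^n,\mu)$ be a symplectic toric manifold. If a $2k$-dimensional symplectic manifold $N^{2k}$ is an equivariant symplectic submanifold of $(M^{2n},\omega,\mathbb T^n,\mu)$, then $N^{2k}$ is also a toric manifold.
   Context: A symplectic toric manifold (toric manifold for short) is a compact connected symplectic manifold $(M^{2n},\omega)$ of dimension $2n$ equipped with an effective Hamiltonian action $\psi$ of the torus $\mathbb T^n$; $\mu:M^{2n}\to\mathbb R^n$ denotes its moment map, where the Lie algebra of $\mathbb T^n$ and its dual are identified with $\mathbb R^n$, and $\iota_{X^{\#}}\omega=d\langle\mu,X\rangle$ for all $X\in\mathbb R^n$, with $X^{\#}$ the vector field generated by $\exp(tX)$. A $2k$-dimensional symplectic manifold $N^{2k}$ is an equivariant symplectic submanifold of the symplectic toric manifold $M^{2n}$ if there are an effective $\mathbb T^k$-action $\psi_1:\mathbb T^k\times N^{2k}\to N^{2k}$, an embedding of Lie groups $\rho:\mathbb T^k\hookrightarrow\mathbb T^n$ and a symplectic embedding $i:N^{2k}\hookrightarrow M^{2n}$ (so the symplectic form on $N^{2k}$ is $i^*\omega$) such that $i(\psi_1(t,q))=\psi(\rho(t),i(q))$ for all $t\in\mathbb T^k$, $q\in N^{2k}$.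
   Formalization: The symplectic manifold N is additionally assumed nonempty, compact and connected; without this the claim fails, e.g. for an open invariant disc in CP^1 with the rotation action, which is not compact and so not toric. *)

(* Defs.v *)
(* Finite-dimensional smooth manifolds are given by charts valued in 'rV[R]_m.
   Tangent vectors and 2-forms are handled through their components in charts,
   vectors being rows, so that the differential of f at x is v |-> v *m 'J f x. *)
From HB Require Import structures.
From mathcomp Require Import all_boot all_order all_algebra.
From mathcomp Require Import ring_quotient generic_quotient.
From mathcomp Require Import all_classical all_reals all_analysis.

Set Implicit Arguments.
Unset Strict Implicit.
Unset Printing Implicit Defensive.

Import Order.TTheory GRing.Theory Num.Theory.
Import numFieldNormedType.Exports.

Local Open Scope classical_set_scope.
Local Open Scope ring_scope.

(* Meant for open U only: on an open set, existence of the differential and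
   j-fold regularity of every directional derivative, for all j. *)
Fixpoint Ck_on (R : realType) (V W : normedModType R) (j : nat) (U : set V)
    (f : V -> W) : Prop :=
  match j with
  | 0 => forall x, U x -> {for x, continuous f}
  | j'.+1 => (forall x, U x -> differentiable f x) /\
             forall v : V, Ck_on j' U (fun x => 'D_v f x)
  end.

Definition smooth_on (R : realType) (V W : normedModType R) (U : set V)
    (f : V -> W) : Prop :=
  forall j, Ck_on j U f.

(* [coord] is only meaningful on [dom], and [param], its inverse, only on
   [coord @` dom]. *)
Record chart (R : realType) (m : nat) (M : Type) := Chart {
  dom : set M;
  coord : M -> 'rV[R]_m;
  param : 'rV[R]_m -> M }.

Definition chart_image (R : realType) m M (c : chart R m M) : set 'rV[R]_m :=
  coord c @` dom c.

Definition topological_chart (R : realType) m (M : topologicalType)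
    (c : chart R m M) : Prop :=
  [/\ open (dom c), open (chart_image c),
      (forall p, dom c p -> {for p, continuous (coord c)}),
      (forall x, chart_image c x -> {for x, continuous (param c)}) &
      (forall p, dom c p -> param c (coord c p) = p)].

Definition is_manifold (R : realType) m (M : topologicalType)
    (A : set (chart R m M)) : Prop :=
  [/\ hausdorff_space M, @second_countable M,
      (forall c, A c -> topological_chart c),
      (forall p, exists2 c, A c & dom c p) &
      (forall c d, A c -> A d ->
         smooth_on (coord c @` (dom c `&` dom d)) (coord d \o param c))].

Record manifold (R : realType) (m : nat) := Manifold {
  mfd_space :> topologicalType;
  atlas : set (chart R m mfd_space);
  manifoldP : is_manifold atlas }.

Arguments atlas {R m} _.

Definition euclidean_atlas (R : realType) (m : nat) :
    set (chart R m 'rV[R]_m) :=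
  [set Chart setT id id].

Definition prod_chart (R : realType) m n M N (c : chart R m M)
    (d : chart R n N) : chart R (m + n) (M * N) :=
  Chart (dom c `*` dom d)
        (fun p => row_mx (coord c p.1) (coord d p.2))
        (fun x => (param c (lsubmx x), param d (rsubmx x))).

Definition prod_atlas (R : realType) m n M N (A : set (chart R m M))
    (B : set (chart R n N)) : set (chart R (m + n) (M * N)) :=
  [set e | exists c d, [/\ A c, B d & e = prod_chart c d]].

Section SmoothMaps.
Variables (R : realType) (m n : nat) (M N : topologicalType).
Variables (A : set (chart R m M)) (B : set (chart R n N)).

Definition local_expr (c : chart R m M) (d : chart R n N) (f : M -> N) :
    'rV[R]_m -> 'rV[R]_n :=
  coord d \o f \o param c.

Definition smooth_map (f : M -> N) : Prop :=
  continuous f /\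
  forall c d, A c -> B d ->
    smooth_on (coord c @` (dom c `&` f @^-1` dom d)) (local_expr c d f).

(* The matrix of the differential of f at p in the charts c and d. *)
Definition differential_mx (c : chart R m M) (d : chart R n N) (f : M -> N)
    (p : M) : 'M[R]_(m, n) :=
  'J (local_expr c d f) (coord c p).

Definition immersion (f : M -> N) : Prop :=
  forall c d p, A c -> B d -> dom c p -> dom d (f p) ->
    row_free (differential_mx c d f p).

Definition topological_embedding (f : M -> N) : Prop :=
  [/\ continuous f, injective f &
      forall U : set M, open U -> exists2 V : set N, open V & U = f @^-1` V].

Definition smooth_embedding (f : M -> N) : Prop :=
  [/\ smooth_map f, immersion f & topological_embedding f].

End SmoothMaps.

(* A field of bilinear forms on the tangent spaces, given by its components:
   [omega c p i j] is omega_p(d_i, d_j) for the coordinate vector fields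
   d_i, d_j of the chart c. *)
Definition bilinear_field (R : realType) m (M : Type) : Type :=
  chart R m M -> M -> 'M[R]_m.

Definition eval_form (R : realType) m (W : 'M[R]_m) (u v : 'rV[R]_m) : R :=
  (u *m W *m v^T) 0 0.

(* f^* omegaN = omegaM *)
Definition pullback_eq (R : realType) m n (M N : topologicalType)
    (A : set (chart R m M)) (B : set (chart R n N)) (f : M -> N)
    (omegaN : bilinear_field R n N) (omegaM : bilinear_field R m M) : Prop :=
  forall c d p, A c -> B d -> dom c p -> dom d (f p) ->
  forall u v : 'rV[R]_m,
    eval_form (omegaM c p) u v =
    eval_form (omegaN d (f p)) (u *m differential_mx c d f p)
                               (v *m differential_mx c d f p).

Section SymplecticForms.
Variables (R : realType) (m : nat) (M : manifold R m).
Variable omega : bilinear_field R m M.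

(* The components in different charts define the same tensor, i.e. they obey
   the transformation law of covariant 2-tensors. *)
Definition chart_compatible : Prop :=
  pullback_eq (atlas M) (atlas M) id omega omega.

Definition form_in_chart (c : chart R m M) (x : 'rV[R]_m) : 'M[R]_m :=
  omega c (param c x).

Definition is_two_form : Prop :=
  [/\ chart_compatible,
      (forall c p, atlas M c -> dom c p -> (omega c p)^T = - omega c p) &
      (forall c, atlas M c -> smooth_on (chart_image c) (form_in_chart c))].

(* The components of d omega on (d_i, d_j, d_l) vanish. *)
Definition closed_form : Prop :=
  forall c x, atlas M c -> chart_image c x -> forall i j l : 'I_m,
    'D_(delta_mx 0 i) (fun y => form_in_chart c y j l) x +
    'D_(delta_mx 0 j) (fun y => form_in_chart c y l i) x +
    'D_(delta_mx 0 l) (fun y => form_in_chart c y i j) x = 0.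

Definition nondegenerate : Prop :=
  forall c p, atlas M c -> dom c p -> omega c p \in unitmx.

Definition is_symplectic : Prop :=
  [/\ is_two_form, closed_form & nondegenerate].

End SymplecticForms.

(* n is half the dimension. *)
Record symplectic_manifold (R : realType) (n : nat) := SymplecticManifold {
  sympl_mfd :> manifold R (2 * n);
  sympl_form : bilinear_field R (2 * n) sympl_mfd;
  sympl_formP : is_symplectic sympl_form }.

Arguments sympl_form {R n} _.

(* T^n = R^n / Z^n, written additively, with the quotient topology. Its Lie
   algebra is R^n, the exponential map being the projection [torus_exp]. *)
Section Torus.
Variables (R : realType) (n : nat).

Definition int_lattice : {pred 'rV[R]_n} :=
  fun x => x \is a mxOver Num.int.

Fact int_lattice_zmod_closed : zmod_closed int_lattice.
Proof.
split=> [|x y]; rewrite !unfold_in; first by apply/mxOverP => i j; rewrite mxE.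
move=> /mxOverP hx /mxOverP hy; apply/mxOverP => i j.
by rewrite !mxE rpredB.
Qed.
HB.instance Definition _ :=
  GRing.isZmodClosed.Build 'rV[R]_n int_lattice int_lattice_zmod_closed.

Definition torus : Type := @Quotient.quot _ int_lattice.

HB.instance Definition _ := GRing.Zmodule.on torus.
HB.instance Definition _ := Quotient.on torus.

Definition torus_exp (X : 'rV[R]_n) : torus := (\pi_torus X)%qT.

Definition torus_open : set_system torus := [set U | open (torus_exp @^-1` U)].

Fact torus_openT : torus_open setT.
Proof. exact: openT. Qed.

Fact torus_openI : setI_closed torus_open.
Proof. by move=> U V; exact: openI. Qed.

Fact torus_open_bigcup (I : Type) (F : I -> set torus) :
  (forall i, torus_open (F i)) -> torus_open (\bigcup_i F i).
Proof. by move=> oF; apply: bigcup_open => j _; exact: oF. Qed.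

HB.instance Definition _ := isOpenTopological.Build torus
  torus_openT torus_openI torus_open_bigcup.

(* [torus_exp] is injective on open balls of radius 1/2 for the sup norm; its
   local inverses there are the charts. *)
Definition torus_chart (X0 : 'rV[R]_n) : chart R n torus :=
  Chart (torus_exp @` ball X0 2^-1)
        (fun t => xget X0 [set X | ball X0 2^-1 X /\ torus_exp X = t])
        torus_exp.

Definition torus_atlas : set (chart R n torus) := range torus_chart.

End Torus.

Definition lie_group_embedding (R : realType) k n (rho : torus R k -> torus R n)
    : Prop :=
  {morph rho : s t / s + t} /\
  smooth_embedding (@torus_atlas R k) (@torus_atlas R n) rho.

Section TorusActions.
Variables (R : realType) (n m : nat) (M : manifold R m).
Variable psi : torus R n -> M -> M.

Definition smooth_action : Prop :=
  [/\ (forall p, psi 0 p = p),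
      (forall s t p, psi (s + t) p = psi s (psi t p)) &
      smooth_map (prod_atlas (@torus_atlas R n) (atlas M)) (atlas M)
        (fun tp : torus R n * M => psi tp.1 tp.2)].

Definition effective : Prop :=
  forall t, (forall p, psi t p = p) -> t = 0.

(* X^#(p) = d/ds exp(sX).p at s = 0, in the chart c. *)
Definition generated_field (X : 'rV[R]_n) (c : chart R m M) (p : M) :
    'rV[R]_m :=
  derive1 (fun s : R => coord c (psi (torus_exp (s *: X)) p)) 0.

Definition pairing (xi X : 'rV[R]_n) : R := \sum_(i < n) xi 0 i * X 0 i.

(* iota_{X^#} omega = d <mu, X> *)
Definition moment_equation (omega : bilinear_field R m M)
    (mu : M -> 'rV[R]_n) : Prop :=
  forall X c p v, atlas M c -> dom c p ->
    eval_form (omega c p) (generated_field X c p) v =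
    'D_v (fun x => pairing (mu (param c x)) X) (coord c p).

Definition is_moment_map (omega : bilinear_field R m M) (mu : M -> 'rV[R]_n) :
    Prop :=
  [/\ smooth_map (atlas M) (@euclidean_atlas R n) mu,
      moment_equation omega mu &
      (forall t p, mu (psi t p) = mu p)].

Definition hamiltonian_action (omega : bilinear_field R m M)
    (mu : M -> 'rV[R]_n) : Prop :=
  [/\ smooth_action,
      (forall t, pullback_eq (atlas M) (atlas M) (psi t) omega omega) &
      is_moment_map omega mu].

End TorusActions.

(* The empty space is not considered as connected. *)
Definition compact_connected (T : topologicalType) : Prop :=
  [/\ compact [set: T], connected [set: T] & [set: T] !=set0].

Definition symplectic_toric (R : realType) n (M : symplectic_manifold R n)
    (psi : torus R n -> M -> M) (mu : M -> 'rV[R]_n) : Prop :=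
  [/\ compact_connected M, effective psi &
      hamiltonian_action psi (sympl_form M) mu].

Arguments symplectic_toric {R n} M psi mu.

Definition symplectic_embedding (R : realType) k n
    (N : symplectic_manifold R k) (M : symplectic_manifold R n) (i : N -> M) :
    Prop :=
  smooth_embedding (atlas N) (atlas M) i /\
  pullback_eq (atlas N) (atlas M) i (sympl_form M) (sympl_form N).

Definition equivariant_symplectic_submanifold (R : realType) k n
    (N : symplectic_manifold R k) (M : symplectic_manifold R n)
    (psi : torus R n -> M -> M) (psi1 : torus R k -> N -> N)
    (rho : torus R k -> torus R n) (i : N -> M) : Prop :=
  [/\ smooth_action psi1, effective psi1, lie_group_embedding rho,
      symplectic_embedding i &
      forall t q, i (psi1 t q) = psi (rho t) (i q)].

Arguments equivariant_symplectic_submanifold {R k n} N M psi psi1 rho i.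

(* Main.v *)
From HB Require Import structures.
From mathcomp Require Import all_boot all_order all_algebra.
From mathcomp Require Import ring_quotient generic_quotient.
From mathcomp Require Import all_classical all_reals all_analysis.
Require Import Defs.

(** The action of T^k on N is Hamiltonian because the moment map of M restricts
    to one for N. The homomorphism rho induces a linear map of Lie algebras,
    X |-> X A, with rho (exp X) = exp (X A) ([torus_hom_exp]). Put
    mu1 = A' o mu o i, where the adjoint A' of A is the right multiplication
    by A^T on row vectors.

    - The equivariance of i makes the vector field X^# on N and the vector field
      (XA)^# on M i-related ([generated_field_pushforward]). Since the form on N
      is the pullback of the form omega on M, contracting it with X^# gives the
      pullback by i of the contraction of omega with (XA)^#, which is
      d<mu, XA>. Hence it is d<mu o i, XA> = d<mu1, X>
      ([moment_equation_pullback]).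
    - The form on N is invariant, because i o psi1 t = psi (rho t) o i and omega
      is invariant ([pullback_invariant]).
    - mu1 is smooth as a composite of smooth maps ([smooth_map_comp], which
      rests on [Ck_on_comp]), and it is invariant because mu is.

    All derivatives are computed in charts, where the chain rule for
    differentials is [differential_mx_comp]. *)

Set Implicit Arguments.
Unset Strict Implicit.
Unset Printing Implicit Defensive.

Import Order.TTheory GRing.Theory Num.Theory.
Import numFieldNormedType.Exports.

Local Open Scope classical_set_scope.
Local Open Scope ring_scope.

(** * Regularity of composite functions *)

Section CkCalculus.
Variable R : realType.
Implicit Types V W : normedModType R.

(** The difference of two functions that agree near x is a little o of anything
    there, so it is differentiable with zero differential. *)
Lemma near_eq_differentiable V W (f g : V -> W) x :
  {near x, f =1 g} -> differentiable f x -> differentiable g x.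
Proof.
move=> fg df; have -> : g = f + (g - f) by rewrite addrC subrK.
apply: differentiableD => //; apply/diff_locallyP.
have o0 : (g - f) \o shift x = cst ((g - f) x) + (\0 : V -> W) +o_ 0 id.
  apply/eqaddoP => _/posnumP[e].
  have fgx : f x = g x := nbhs_singleton fg.
  have : \forall y \near 0, f (y + x) = g (y + x).
    by move: fg; rewrite [X in X -> _](near_shift 0)/= subr0.
  apply: filterS => y fgy; rewrite !fctE /= fgx fgy !subrr addr0 subr0 normr0.
  by rewrite mulr_ge0.
have c0 : continuous (\0 : V -> W) by exact: cst_continuous.
by rewrite (diff_unique c0 o0).
Qed.

Lemma derive_chain (V V' W : normedModType R) (f : V -> V') (g : V' -> W) x v :
  differentiable f x -> differentiable g (f x) ->
  'D_v (g \o f) x = 'D_('D_v f x) g (f x).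
Proof.
move=> df dg; rewrite (deriveE _ (differentiable_comp df dg)).
by rewrite (deriveE _ dg) (deriveE _ df) diff_comp.
Qed.

Lemma Ck_onS V W j (U U' : set V) (f : V -> W) :
  U' `<=` U -> Ck_on j U f -> Ck_on j U' f.
Proof.
move=> sU; elim: j f => [|j IH] f /=; first by move=> h x /sU; exact: h.
by move=> [df Df]; split=> [x /sU|v]; [exact: df|exact: IH].
Qed.

(** Openness of U matters: it makes two functions that agree on U agree near
    each of its points, hence have the same directional derivatives there. *)
Lemma Ck_on_eq V W j (U : set V) (f g : V -> W) :
  open U -> {in U, f =1 g} -> Ck_on j U f -> Ck_on j U g.
Proof.
move=> oU; elim: j f g => [|j IH] f g fg /=.
  move=> cf x Ux; have nfg : {near x, f =1 g}.
    by apply: filterS (open_nbhs_nbhs (conj oU Ux)) => y Uy; apply/fg/mem_set.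
  move: (cf x Ux); rewrite /prop_for /continuous_at (nbhs_singleton nfg).
  exact: cvg_trans (near_eq_cvg nfg).
have nfg x : U x -> {near x, f =1 g}.
  move=> Ux; apply: filterS (open_nbhs_nbhs (conj oU Ux)) => y Uy.
  exact/fg/mem_set.
move=> [df Df]; split=> [x Ux|v].
  exact: near_eq_differentiable (nfg x Ux) (df x Ux).
apply: IH (Df v) => x /set_mem Ux.
by apply: near_eq_derive; exact: nfg.
Qed.

(** [Ck_on] only speaks of germs at the points of U, so it can be checked
    around each point separately. *)
Lemma Ck_on_local V W j (U : set V) (f : V -> W) :
  (forall x, U x -> exists2 U', U' x & Ck_on j U' f) -> Ck_on j U f.
Proof.
elim: j f => [|j IH] f h /=.
  by move=> x /h[U' U'x]; exact.
split=> [x /h[U' U'x [df _]]|v]; first exact: df.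
by apply: IH => x /h[U' U'x [_ Df]]; exists U' => //; exact: Df.
Qed.

Lemma Ck_onW V W j (U : set V) (f : V -> W) : Ck_on j.+1 U f -> Ck_on j U f.
Proof.
elim: j f => [|j IH] f [df Df].
  by move=> x Ux; exact/differentiable_continuous/df.
by split=> // v; apply: IH; exact: Df.
Qed.

Lemma derive_lin V W W' (L : {linear W -> W'}) (f : V -> W) x v :
  continuous L -> differentiable f x ->
  'D_v (L \o f) x = L ('D_v f x).
Proof.
move=> cL df; have dL := linear_differentiable (f x) cL.
by rewrite (derive_chain _ df dL) deriveE // diff_lin.
Qed.

Lemma Ck_on_lin V W W' j (U : set V) (L : {linear W -> W'}) (f : V -> W) :
  open U -> continuous L -> Ck_on j U f -> Ck_on j U (L \o f).
Proof.
move=> oU cL; elim: j f => [|j IH] f /=.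
  move=> cf x Ux; apply: continuous_comp; [exact: cf|exact: cL].
move=> [df Df]; split=> [x Ux|v].
  by apply: differentiable_comp; [exact: df|exact: linear_differentiable].
apply: Ck_on_eq (IH _ (Df v)) => // x /set_mem Ux /=.
by rewrite derive_lin //; exact: df.
Qed.

Lemma Ck_onD V W j (U : set V) (f g : V -> W) :
  open U -> Ck_on j U f -> Ck_on j U g -> Ck_on j U (f + g).
Proof.
move=> oU; elim: j f g => [|j IH] f g /=.
  move=> cf cg x Ux; apply: continuousD; [exact: cf|exact: cg].
move=> [df Df] [dg Dg]; split=> [x Ux|v].
  by apply: differentiableD; [exact: df|exact: dg].
apply: Ck_on_eq (IH _ _ (Df v) (Dg v)) => // x /set_mem Ux /=.
by rewrite deriveD //; apply: diff_derivable; [exact: df|exact: dg].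
Qed.

Lemma Ck_on_cst V W j (U : set V) (w : W) : Ck_on j U (cst w).
Proof.
elim: j w => [|j IH] w /=; first by move=> x _; exact: cst_continuous.
split=> [x _|v]; first exact: differentiable_cst.
have -> : (fun x : V => 'D_v (cst w) x) = cst 0.
  by apply/funext => x; rewrite derive_cst.
exact: IH.
Qed.

Lemma Ck_on_sum V W j (U : set V) m (f : 'I_m -> V -> W) :
  open U -> (forall i, Ck_on j U (f i)) -> Ck_on j U (\sum_i f i).
Proof.
move=> oU Cf; apply: (big_ind (Ck_on j U)) => //; first exact: Ck_on_cst.
by move=> *; exact: Ck_onD.
Qed.

(** The product rule, from the differential of the bilinear map [*:%R]. *)
Lemma is_diff_scale V W (a : V -> R) (b : V -> W) x :
  differentiable a x -> differentiable b x ->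
  is_diff x (fun y => a y *: b y)
    (fun v => a x *: 'd b x v + 'd a x v *: b x).
Proof.
move=> da db.
have bilM : bilinear_for (GRing.Scale.Law.clone _ _ *:%R _)
    (GRing.Scale.Law.clone _ _ *:%R _) (@GRing.scale R W : R -> W -> W).
  by split=> [u|u] c y z /=; rewrite ?scalerDl ?scalerDr !scalerA // mulrC.
pose s : {bilinear R -> W -> W} :=
  HB.pack (@GRing.scale R W : R -> W -> W)
   (bilinear_isBilinear.Build R R W W _ _ (@GRing.scale R W) bilM).
have cs : continuous (fun p => s p.1 p.2) by exact: scale_continuous.
have ds p := differentiable_bilin p cs.
have dab : differentiable (fun y => (a y, b y)) x by exact: differentiable_pair.
have -> : (fun y => a y *: b y) = (fun p => s p.1 p.2) \o (fun y => (a y, b y)).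
  by [].
apply: DiffDef; first exact: differentiable_comp.
by rewrite diff_comp // diff_bilin // diff_pair.
Qed.

Lemma Ck_onZ V W j (U : set V) (a : V -> R) (b : V -> W) :
  open U -> Ck_on j U a -> Ck_on j U b -> Ck_on j U (fun x => a x *: b x).
Proof.
move=> oU; elim: j a b => [|j IH] a b.
  move=> ca cb x Ux; apply: continuousZ; [exact: ca|exact: cb].
move=> Ca Cb; have [[da Da] [db Db]] := (Ca, Cb).
have dab x Ux := is_diff_scale (da x Ux) (db x Ux).
split=> [x Ux|v]; first by have := dab x Ux.
apply: Ck_on_eq (Ck_onD oU (IH _ _ (Ck_onW Ca) (Db v))
                           (IH _ _ (Da v) (Ck_onW Cb))) => // x /set_mem Ux.
have [dax dbx] := (da x Ux, db x Ux); have D := dab x Ux.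
by rewrite fctE !deriveE // diff_val.
Qed.

(** The chain rule in the form needed for an induction on the regularity: the
    directions on the right are fixed basis vectors, so that each factor is
    again one of the functions whose regularity [Ck_on] records. *)
Lemma derive_comp_rV V W m (f : V -> 'rV[R]_m) (g : 'rV[R]_m -> W) x v :
  differentiable f x -> differentiable g (f x) ->
  'D_v (g \o f) x = \sum_l ('D_v f x) 0 l *: 'D_(delta_mx 0 l) g (f x).
Proof.
move=> df dg; rewrite (derive_chain _ df dg) (deriveE _ dg).
rewrite {1}(row_sum_delta ('D_v f x)) linear_sum.
by apply: eq_bigr => l _; rewrite linearZ (deriveE _ dg).
Qed.

(** By induction on j: the derivative of the composite is a finite sum of
    products of a coordinate of the derivative of f with a composite of f and a
    partial derivative of g, all of which are one degree less regular. *)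
Lemma Ck_on_comp V W m j (U : set V) (U' : set 'rV[R]_m)
    (f : V -> 'rV[R]_m) (g : 'rV[R]_m -> W) :
  open U -> (forall x, U x -> U' (f x)) ->
  Ck_on j U f -> Ck_on j U' g -> Ck_on j U (g \o f).
Proof.
move=> oU fU; elim: j f g fU => [|j IH] f g fU.
  by move=> cf cg x Ux; apply: continuous_comp; [exact: cf|exact/cg/fU].
move=> Cf [dg Dg]; have [df Df] := Cf; split=> [x Ux|v].
  by apply: differentiable_comp; [exact: df|exact/dg/fU].
pose t l x := ('D_v f x) 0 l *: 'D_(delta_mx 0 l) g (f x).
apply: (@Ck_on_eq _ _ _ _ (\sum_l t l)) => // [x /set_mem Ux|].
  by rewrite fct_sumE derive_comp_rV //; [exact: df|exact/dg/fU].
apply: Ck_on_sum => // l; apply: Ck_onZ => //.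
  have Llin : linear (fun u : 'rV[R]_m => u 0 l : R).
    by move=> c u w; rewrite !mxE.
  pose L : {linear 'rV[R]_m -> R} :=
    HB.pack (fun u : 'rV[R]_m => u 0 l : R)
      (GRing.isLinear.Build _ _ _ _ _ Llin).
  exact: (@Ck_on_lin _ _ _ _ _ L _ oU (@coord_continuous _ _ _ _ _) (Df v)).
by apply: IH (Ck_onW Cf) (Dg _).
Qed.

End CkCalculus.

(** * Smooth maps in charts and the chain rule *)

Section Charts.
Variable R : realType.

Lemma open_coord_image m (M : topologicalType) (c : chart R m M) (U : set M) :
  topological_chart c -> open U -> open (coord c @` (dom c `&` U)).
Proof.
move=> [_ oI _ cp cK] oU.
have -> : coord c @` (dom c `&` U) = chart_image c `&` param c @^-1` U.
  apply/seteqP; split=> x /= [].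
    by move=> p [cp' Up] <-; split; [exists p|rewrite cK].
  by case=> p dp <-; rewrite cK // => Up; exists p.
rewrite openE => x [Ix Ux]; apply: filterI.
  exact: open_nbhs_nbhs.
exact: (cp x Ix _ (open_nbhs_nbhs (conj oU Ux))).
Qed.

Lemma near_coord m (M : topologicalType) (c : chart R m M) (U : set M) p :
  topological_chart c -> open U -> dom c p -> U p ->
  \forall x \near coord c p, dom c (param c x) /\ U (param c x).
Proof.
move=> tc oU dp Up; have [_ _ _ _ cK] := tc.
have : nbhs (coord c p) (coord c @` (dom c `&` U)).
  by apply: open_nbhs_nbhs; split; [exact: open_coord_image|exists p].
by apply: filterS => x [q [dq Uq] <-]; rewrite cK.
Qed.

Lemma jacobian_comp m n l (f : 'rV[R]_m -> 'rV[R]_n)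
    (g : 'rV[R]_n -> 'rV[R]_l) x :
  differentiable f x -> differentiable g (f x) ->
  'J (g \o f) x = 'J f x *m 'J g (f x).
Proof.
move=> df dg; apply/row_matrixP => i.
rewrite !rowE mulmxA -(deriveEjacobian _ (differentiable_comp df dg)).
by rewrite -(deriveEjacobian _ df) -(deriveEjacobian _ dg) -derive_chain.
Qed.

Section Composition.
Variables (m n l : nat) (M N P : topologicalType).
Variables (c : chart R m M) (d : chart R n N) (e : chart R l P).
Variables (f : M -> N) (g : N -> P).
Hypotheses (tc : topological_chart c) (td : topological_chart d).
Hypothesis cf : continuous f.

(** The equality is local: outside f^-1 of the domain of d, [param d] does not
    undo [coord d]. *)
Lemma local_expr_comp p : dom c p -> dom d (f p) ->
  \forall x \near coord c p,
    local_expr c e (g \o f) x = (local_expr d e g \o local_expr c d f) x.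
Proof.
move=> dp dfp; have [od _ _ _ dK] := td.
have oU : open (f @^-1` dom d) by apply: open_comp od => q _; exact: cf.
apply: filterS (near_coord tc oU dp dfp) => x [_ dx] /=.
by rewrite /local_expr /= dK.
Qed.

Lemma differential_mx_comp p : dom c p -> dom d (f p) ->
  differentiable (local_expr c d f) (coord c p) ->
  differentiable (local_expr d e g) (coord d (f p)) ->
  differential_mx c e (g \o f) p =
  differential_mx c d f p *m differential_mx d e g (f p).
Proof.
move=> dp dfp df dg; have [_ _ _ _ cK] := tc.
have fp : local_expr c d f (coord c p) = coord d (f p).
  by rewrite /local_expr /= cK.
have dgf : differentiable (local_expr d e g) (local_expr c d f (coord c p)).
  by rewrite fp.
transitivity ('J (local_expr d e g \o local_expr c d f) (coord c p));
  last first.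
  by rewrite (jacobian_comp df dgf) fp.
have {}dgf := differentiable_comp df dgf.
have nfg := local_expr_comp dp dfp.
have dh : differentiable (local_expr c e (g \o f)) (coord c p).
  apply: (near_eq_differentiable _ dgf); apply: filterS nfg => x fgx.
  exact: esym fgx.
apply/row_matrixP => i.
rewrite [LHS]rowE [RHS]rowE.
transitivity ('D_(delta_mx 0 i) (local_expr c e (g \o f)) (coord c p)).
  by rewrite (deriveEjacobian _ dh).
rewrite -(deriveEjacobian _ dgf).
exact: near_eq_derive.
Qed.

End Composition.

Lemma smooth_map_differentiable m n (M N : topologicalType)
    (A : set (chart R m M)) (B : set (chart R n N)) (f : M -> N) c d p :
  smooth_map A B f -> A c -> B d -> dom c p -> dom d (f p) ->
  differentiable (local_expr c d f) (coord c p).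
Proof.
by move=> [_ sf] Ac Bd dp dfp; have [+ _] := sf c d Ac Bd 1; apply; exists p.
Qed.

(** Around each point one inserts a chart of the middle manifold; this is why
    [Ck_on_local] and the openness of the domains are needed. *)
Lemma smooth_map_comp m n l (M N P : topologicalType)
    (A : set (chart R m M)) (B : set (chart R n N)) (C : set (chart R l P))
    (f : M -> N) (g : N -> P) :
  (forall c, A c -> topological_chart c) ->
  (forall d, B d -> topological_chart d) ->
  (forall q, exists2 d, B d & dom d q) ->
  (forall e, C e -> open (dom e)) ->
  smooth_map A B f -> smooth_map B C g -> smooth_map A C (g \o f).
Proof.
move=> tA tB covB oC [cf sf] [cg sg]; split.
  by move=> p; apply: continuous_comp; [exact: cf|exact: cg].
move=> c e Ac Ce j; apply: Ck_on_local => _ [p [dp /= egfp] <-].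
have [d Bd dfp] := covB (f p).
have [od _ _ _ dK] := tB d Bd; have [_ _ _ _ cK] := tA c Ac.
(* On the chart image of U the factorization through d is valid. *)
pose U := f @^-1` (dom d `&` g @^-1` dom e).
have oU : open U.
  apply: open_comp => [q _|]; first exact: cf.
  by apply: openI => //; apply: open_comp (oC e Ce) => q _; exact: cg.
exists (coord c @` (dom c `&` U)); first by exists p.
have oI := open_coord_image (tA c Ac) oU.
apply: (@Ck_on_eq _ _ _ _ _ (local_expr d e g \o local_expr c d f)) => //.
  by move=> _ /set_mem[q [dq [dfq _]] <-]; rewrite /local_expr /= cK // dK.
apply: Ck_on_comp (sg d e Bd Ce j) => //.
  move=> _ [q [dq [dfq egq]] <-]; exists (f q) => //.
  by rewrite /local_expr /= cK.
by apply: Ck_onS (sf c d Ac Bd j) => _ [q [dq [dfq egq]] <-]; exists q.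
Qed.

Lemma manifold_chart m (M : manifold R m) c : atlas M c -> topological_chart c.
Proof. by have [_ _ + _ _] := manifoldP M; exact. Qed.

Lemma manifold_cover m (M : manifold R m) p : exists2 c, atlas M c & dom c p.
Proof. by have [_ _ _ + _] := manifoldP M; exact. Qed.

End Charts.

(** * The exponential map and homomorphisms of tori *)

Section Torus.
Variable R : realType.

Section Exponential.
Variable n : nat.
Implicit Types X Y : 'rV[R]_n.

Lemma torus_exp_eq X Y : (torus_exp X = torus_exp Y) <-> int_lattice (X - Y).
Proof.
have E := @Quotient.idealrBE _ (@int_lattice R n) X Y.
change (torus_exp X = torus_exp Y <-> X - Y \in @int_lattice R n).
by rewrite E; split=> [XY|/eqP//]; apply/eqP.
Qed.

Lemma torus_expD X Y : torus_exp (X + Y) = torus_exp X + torus_exp Y.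
Proof. exact: (Quotient.pi_add (@int_lattice R n) X Y). Qed.

Lemma torus_exp0 : torus_exp (0 : 'rV[R]_n) = 0.
Proof. by apply: (addrI (torus_exp 0)); rewrite -torus_expD !addr0. Qed.

Lemma torus_expMn X j : torus_exp (X *+ j) = torus_exp X *+ j.
Proof. by elim: j => [|j IH]; rewrite ?torus_exp0 // !mulrS torus_expD IH. Qed.

Lemma torus_exp_surj (t : torus R n) : exists X, torus_exp X = t.
Proof. by exists (repr t); rewrite /torus_exp reprK. Qed.

Lemma torus_exp_continuous : continuous (@torus_exp R n).
Proof. by apply/continuousP => U. Qed.

(** The saturation of U is the union of its translates by lattice vectors. *)
Lemma torus_exp_open (U : set 'rV[R]_n) : open U -> open (@torus_exp R n @` U).
Proof.
move=> oU; suff : open (@torus_exp R n @^-1` (@torus_exp R n @` U)) by [].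
have -> : @torus_exp R n @^-1` (@torus_exp R n @` U) =
    \bigcup_(Z in [set Z : 'rV[R]_n | torus_exp Z = 0]) ((+%R^~ Z) @^-1` U).
  apply/seteqP; split=> X /=.
    case=> Y UY YX; exists (Y - X); last by rewrite /= addrC subrK.
    by apply: (addrI (torus_exp X)); rewrite -torus_expD addrC subrK addr0.
  by case=> Z /= Z0 UXZ; exists (X + Z) => //; rewrite torus_expD Z0 addr0.
apply: bigcup_open => Z _; apply: open_comp oU => X _.
exact/continuousD/cst_continuous.
Qed.

(** A lattice vector of sup norm less than 1 has integer entries of absolute
    value less than 1, so it is zero. *)
Lemma torus_exp_inj_ball X Y : `|X - Y| < 1 ->
  torus_exp X = torus_exp Y -> X = Y.
Proof.
move=> lt1 /torus_exp_eq/mxOverP XYint; apply/matrixP => i j.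
apply/eqP; rewrite -subr_eq0; apply/negPn/negP => XYn0.
have /norm_intr_ge1/(_ XYn0) : X i j - Y i j \is a Num.int.
  by have := XYint i j; rewrite !mxE.
rewrite leNgt => /negP; apply.
move: lt1; rewrite {1}/Num.norm/= mx_normrE => /bigmax_ltP[_ h].
by have := h (i, j) isT; rewrite !mxE.
Qed.

Lemma torus_chartK X0 X :
  ball X0 2^-1 X -> coord (torus_chart X0) (torus_exp X) = X.
Proof.
move=> bX /=; set P := [set Y | _].
have [bY YX] : P (xget X0 P) by apply: (@xgetPex _ X0); exists X.
apply: torus_exp_inj_ball => //; move: (ball_triangle (ball_sym bY) bX).
by rewrite -ball_normE /= -div1r -splitr.
Qed.

(** A fibre meets a ball of radius 1/2 in at most one point, so it has no
    accumulation point. *)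
Lemma torus_fiber_closed t : closed [set X : 'rV[R]_n | torus_exp X = t].
Proof.
move=> X clX; have e2 : 0 < 2^-1 :> R by rewrite invr_gt0.
have [Y [/= Yt]] := clX _ (nbhsx_ballx X _ e2).
rewrite -ball_normE /= => bY.
suff -> : X = Y by [].
apply/eqP; rewrite -subr_eq0 -normr_eq0; apply/negPn/negP => XY0.
have e0 : 0 < Num.min 2^-1 `|X - Y|.
  by rewrite lt_min invr_gt0 ltr0n lt_def XY0 normr_ge0.
have [Z [/= Zt]] := clX _ (nbhsx_ballx X _ e0).
rewrite -ball_normE /= lt_min => /andP[bZ]; suff -> : Z = Y by rewrite ltxx.
apply: torus_exp_inj_ball; last by rewrite Zt.
by rewrite (le_lt_trans (ler_distD X _ _))// (splitr 1) div1r ltrD // distrC.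
Qed.

End Exponential.

Lemma dom_torus_chart n (X : 'rV[R]_n) : dom (torus_chart X) (torus_exp X).
Proof. by exists X => //; apply: ballxx; rewrite invr_gt0. Qed.

Lemma torus_chart_center n (X : 'rV[R]_n) :
  coord (torus_chart X) (torus_exp X) = X.
Proof. by apply: torus_chartK; apply: ballxx; rewrite invr_gt0. Qed.

(** A smooth homomorphism of tori is linear on the Lie algebras, its matrix
    being the differential at the identity. In the charts centred at 0, rho is a
    function f with f 0 = 0, and exp (f x) = rho (exp x) for x near 0. Therefore
    exp (j f (X / j)) = j (rho (exp (X / j))) = rho (exp X) for j large, while
    j f (X / j) tends to the derivative of f at 0 along X. As the fibres of exp
    are closed, the limit still lies over rho (exp X). *)
Lemma torus_hom_exp k n (rho : torus R k -> torus R n) :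
  {morph rho : s t / s + t} ->
  smooth_map (@torus_atlas R k) (@torus_atlas R n) rho ->
  forall X, rho (torus_exp X) =
    torus_exp (X *m differential_mx (torus_chart 0) (torus_chart 0) rho 0).
Proof.
move=> rhoD srho X.
have rho0 : rho 0 = 0 by apply: (addrI (rho 0)); rewrite -rhoD !addr0.
have rhoMn t j : rho (t *+ j) = rho t *+ j.
  by elim: j => [|j IH]; rewrite ?mulr0n // !mulrS rhoD IH.
pose c : chart R k (torus R k) := torus_chart 0.
pose d : chart R n (torus R n) := torus_chart 0.
have dc0 : dom c 0 by rewrite -torus_exp0; exact: dom_torus_chart.
have dd0 : dom d 0 by rewrite -torus_exp0; exact: dom_torus_chart.
have c0 : coord c 0 = 0 by rewrite -{1}torus_exp0 torus_chart_center.
have d0 : coord d 0 = 0 by rewrite -{1}torus_exp0 torus_chart_center.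
pose f := local_expr c d rho.
have df : differentiable f 0.
  rewrite -c0; apply: (smooth_map_differentiable srho); [by exists 0..|by []|].
  by rewrite rho0.
have fE x : f x = coord d (rho (torus_exp x)) by [].
have f0 : f 0 = 0 by rewrite fE torus_exp0 rho0 d0.
have expf : \forall x \near (0 : 'rV[R]_k), torus_exp (f x) = rho (torus_exp x).
  have : \forall x \near (0 : 'rV[R]_k), dom d (rho (torus_exp x)).
    have crho : {for 0, continuous (rho \o @torus_exp R k)}.
      apply: continuous_comp; [exact: torus_exp_continuous|exact: srho.1].
    apply: crho; apply: open_nbhs_nbhs; split.
      by apply: torus_exp_open; exact: ball_open.
    by rewrite /= torus_exp0 rho0.
  apply: filterS => x [Y bY Yx].
  by rewrite fE -Yx torus_chartK.
rewrite /differential_mx -/c -/d -/f c0 -(deriveEjacobian _ df).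
(* The difference quotients of f at 0 along X, for the steps 1 / (j + 1). *)
apply/esym; pose u j := j.+1%:R *: f (harmonic j *: X).
have h0 : (harmonic : R^nat) @ \oo --> 0^'.
  move=> A [e /= e0 eA].
  have /cvgrPdist_lt/(_ e e0) := @cvg_harmonic R.
  apply: filterS => j hj; apply: eA; first exact: hj.
  by rewrite /harmonic invr_eq0 pnatr_eq0.
have fiber := torus_fiber_closed (t := rho (torus_exp X)).
apply: (@closed_cvg _ _ \oo _ u _ fiber).
  have : \forall j \near \oo,
      torus_exp (f (harmonic j *: X)) = rho (torus_exp (harmonic j *: X)).
    have hX : (fun j => harmonic j *: X : 'rV[R]_k) @ \oo --> (0 : 'rV[R]_k).
      by rewrite -(scale0r X); apply: cvgZr_tmp; exact: cvg_harmonic.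
    exact: hX _ expf.
  apply: filterS => j /= fj.
  rewrite /u scaler_nat torus_expMn fj -rhoMn -torus_expMn -scaler_nat scalerA.
  by rewrite divff ?scale1r // pnatr_eq0.
have -> : u = (fun h => h^-1 *: (f (h *: X + 0) - f 0)) \o harmonic.
  by apply/funext => j; rewrite /= f0 subr0 addr0 invrK.
apply: cvg_comp h0 _.
exact: diff_derivable df.
Qed.

End Torus.

(** * Linear maps and the duality pairing *)

Section Linear.
Variable R : realType.

Lemma mulmxr_continuous m n (B : 'M[R]_(m, n)) :
  continuous (fun x : 'rV[R]_m => x *m B).
Proof.
have -> : (fun x : 'rV[R]_m => x *m B) = \sum_i (fun x => x 0 i *: row i B).
  by apply/funext => x; rewrite fct_sumE mulmx_sum_row.
elim/big_ind : _ => [|f g cf cg|i _] x.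
- exact: cst_continuous.
- by apply: continuousD; [exact: cf|exact: cg].
- apply: differentiable_continuous; apply: differentiableZl.
  exact: differentiable_coord.
Qed.

Lemma differentiable_mulmxr m n (B : 'M[R]_(m, n)) (x : 'rV[R]_m) :
  differentiable (fun x : 'rV[R]_m => x *m B) x.
Proof.
exact: (@linear_differentiable _ _ _ (mulmxr B)) (@mulmxr_continuous m n B).
Qed.

Lemma pairingE n (xi X : 'rV[R]_n) : pairing xi X = (xi *m X^T) 0 0.
Proof. by rewrite mxE; apply: eq_bigr => i _; rewrite mxE. Qed.

Lemma pairing_mulmx k n (xi : 'rV[R]_n) (X : 'rV[R]_k) (A : 'M[R]_(k, n)) :
  pairing (xi *m A^T) X = pairing xi (X *m A).
Proof. by rewrite !pairingE trmx_mul mulmxA. Qed.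

Lemma differentiable_pairing n (X xi : 'rV[R]_n) :
  differentiable (fun xi => pairing xi X) xi.
Proof.
have -> : (fun xi => pairing xi X) =
    (fun N : 'M[R]_1 => N 0 0 : R) \o (fun xi : 'rV[R]_n => xi *m X^T).
  by apply/funext => y; rewrite pairingE.
apply: differentiable_comp; first exact: differentiable_mulmxr.
exact: differentiable_coord.
Qed.

Lemma smooth_map_mulmxr m n l (M : topologicalType) (A : set (chart R m M))
    (f : M -> 'rV[R]_n) (B : 'M[R]_(n, l)) :
  (forall c, A c -> topological_chart c) ->
  smooth_map A (@euclidean_atlas R n) f ->
  smooth_map A (@euclidean_atlas R l) (fun p => f p *m B).
Proof.
move=> tA [cf sf]; split.
  move=> p; apply: (@continuous_comp _ _ _ f (fun x => x *m B)).
    exact: cf.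
  exact: mulmxr_continuous.
move=> c _ Ac -> j.
have oI : open (coord c @` (dom c `&` setT)).
  exact: open_coord_image (tA c Ac) openT.
have cL : continuous (mulmxr B : 'rV[R]_n -> 'rV[R]_l).
  exact: mulmxr_continuous.
exact: (Ck_on_lin oI cL (sf c _ Ac erefl j)).
Qed.

End Linear.

(** * Smooth torus actions in charts *)

Section Action.
Variables (R : realType) (n m : nat) (M : manifold R m).
Variable psi : torus R n -> M -> M.
Hypothesis psi_smooth : smooth_action psi.

(** The action in coordinates is differentiable jointly in the group element
    exp X and the point. Restricting it to x |-> (X, x) or to s |-> (s X, p)
    gives the differentiability of each transformation and of each orbit curve. *)
Lemma differentiable_action X c d p : atlas M c -> atlas M d ->
  dom c p -> dom d (psi (torus_exp X) p) ->
  differentiable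
    (local_expr (prod_chart (torus_chart X) c) d (fun tp => psi tp.1 tp.2))
    (row_mx X (coord c p)).
Proof.
move=> Ac Ad dp dpsi; have [_ _ sm] := psi_smooth.
have := @smooth_map_differentiable _ _ _ _ _ _ _ _
  (prod_chart (torus_chart X) c) d (torus_exp X, p) sm.
rewrite [coord (prod_chart _ _) _]/(row_mx _ _) torus_chart_center.
apply => //; first by exists (torus_chart X), c; split => //; exists X.
by split=> //; exact: dom_torus_chart.
Qed.

Lemma action_continuous t : continuous (psi t).
Proof.
have [_ _ [cpsi _]] := psi_smooth => p.
apply: (@continuous_comp _ _ _ (fun q => (t, q)) (fun tp => psi tp.1 tp.2)).
  exact: (cvg_pair (cvg_cst t) (@cvg_id _ (nbhs p))).
exact: cpsi.
Qed.

Lemma differentiable_action_elt t c d p : atlas M c -> atlas M d ->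
  dom c p -> dom d (psi t p) ->
  differentiable (local_expr c d (psi t)) (coord c p).
Proof.
move=> Ac Ad dp; have [X <-] := torus_exp_surj t => dpsi.
pose F (x : 'rV[R]_m) : 'rV[R]_(n + m) :=
  row_mx X 0 + x *m row_mx (0 : 'M[R]_(m, n)) 1%:M.
have FE x : F x = row_mx X x.
  by rewrite /F mul_mx_row mulmx0 mulmx1 add_row_mx addr0 add0r.
have -> : local_expr c d (psi (torus_exp X)) =
    local_expr (prod_chart (torus_chart X) c) d (fun tp => psi tp.1 tp.2) \o F.
  by apply/funext => x; rewrite /local_expr /= FE row_mxKl row_mxKr.
apply: differentiable_comp; last by rewrite FE; exact: differentiable_action.
apply: differentiableD; first exact: differentiable_cst.
exact: differentiable_mulmxr.
Qed.

Lemma orbit_continuous (X : 'rV[R]_n) p :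
  continuous (fun s : R => psi (torus_exp (s *: X)) p).
Proof.
have [_ _ [cpsi _]] := psi_smooth => s.
apply: (@continuous_comp _ _ _ (fun s : R => (torus_exp (s *: X), p))
  (fun tp => psi tp.1 tp.2)); last exact: cpsi.
have h : {for s, continuous (@torus_exp R n \o (fun s : R => s *: X))}.
  by apply: continuous_comp;
    [exact: scalel_continuous|exact: torus_exp_continuous].
exact: (cvg_pair h (cvg_cst p)).
Qed.

Lemma differentiable_orbit (X : 'rV[R]_n) c p : atlas M c -> dom c p ->
  differentiable (fun s : R => coord c (psi (torus_exp (s *: X)) p)) 0.
Proof.
move=> Ac dp; have [psi0 _ _] := psi_smooth.
have [_ _ _ _ cK] := manifold_chart Ac.
pose F (s : R) : 'rV[R]_(n + m) :=
  row_mx 0 (coord c p) + s *: row_mx X (0 : 'rV[R]_m).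
have FE s : F s = row_mx (s *: X) (coord c p).
  by rewrite /F scale_row_mx scaler0 add_row_mx add0r addr0.
have -> : (fun s : R => coord c (psi (torus_exp (s *: X)) p)) =
    local_expr (prod_chart (torus_chart 0) c) c (fun tp => psi tp.1 tp.2) \o F.
  by apply/funext => s; rewrite /local_expr /= FE row_mxKl row_mxKr cK.
apply: differentiable_comp; last first.
  rewrite FE scale0r; apply: differentiable_action => //.
  by rewrite torus_exp0 psi0.
apply: differentiableD; first exact: differentiable_cst.
by apply: differentiableZl.
Qed.

End Action.

(** * Equivariant submanifolds *)

Section Equivariant.
Variables (R : realType) (k n kN mM : nat).
Variables (N : manifold R kN) (M : manifold R mM).
Variables (psi1 : torus R k -> N -> N) (psi : torus R n -> M -> M).
Variables (rho : torus R k -> torus R n) (i : N -> M).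
Hypotheses (psi1_smooth : smooth_action psi1) (psi_smooth : smooth_action psi).
Hypothesis i_smooth : smooth_map (atlas N) (atlas M) i.
Hypothesis i_equivariant : forall t q, i (psi1 t q) = psi (rho t) (i q).

(** Both sides of the equivariance relation pull omegaM back to the same form:
    along psi (rho t) o i one gets omegaN, along i o psi1 t its pullback by
    psi1 t. *)
Lemma pullback_invariant (omegaM : bilinear_field R mM M)
    (omegaN : bilinear_field R kN N) t :
  pullback_eq (atlas N) (atlas M) i omegaM omegaN ->
  pullback_eq (atlas M) (atlas M) (psi (rho t)) omegaM omegaM ->
  pullback_eq (atlas N) (atlas N) (psi1 t) omegaN omegaN.
Proof.
move=> iO psiO c d p Ac Ad dp dpsi1 u v.
have [e Ae de] := manifold_cover (i p).
have [f Af df] := manifold_cover (i (psi1 t p)).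
have df' : dom f (psi (rho t) (i p)) by rewrite -i_equivariant.
have Dl := differential_mx_comp (manifold_chart Ac) (manifold_chart Ad)
  (action_continuous psi1_smooth (t := t)) dp dpsi1
  (differentiable_action_elt psi1_smooth Ac Ad dp dpsi1)
  (smooth_map_differentiable i_smooth Ad Af dpsi1 df).
have Dr := differential_mx_comp (manifold_chart Ac) (manifold_chart Ae)
  i_smooth.1 dp de (smooth_map_differentiable i_smooth Ac Ae dp de)
  (differentiable_action_elt psi_smooth Ae Af de df').
have comp_eq : i \o psi1 t = psi (rho t) \o i.
  by apply/funext => q; exact: i_equivariant.
rewrite (iO c e p) // (psiO e f (i p)) // (iO d f (psi1 t p)) //.
by rewrite -!mulmxA -Dl -Dr comp_eq i_equivariant.
Qed.

(** Equivariance identifies i (exp(sX).p) with exp(sXA).i(p); the velocities at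
    s = 0 then agree by the chain rule: X^# and (XA)^# are i-related. *)
Lemma generated_field_pushforward (A : 'M[R]_(k, n)) X c d p :
  (forall X, rho (torus_exp X) = torus_exp (X *m A)) ->
  atlas N c -> atlas M d -> dom c p -> dom d (i p) ->
  generated_field psi (X *m A) d (i p) =
  generated_field psi1 X c p *m differential_mx c d i p.
Proof.
move=> rhoA Ac Ad dp dip; have [psi10 _ _] := psi1_smooth.
have [_ _ _ _ cK] := manifold_chart Ac.
pose g (s : R) := coord c (psi1 (torus_exp (s *: X)) p).
have g0 : g 0 = coord c p by rewrite /g scale0r torus_exp0 psi10.
have dg : differentiable g 0 := differentiable_orbit psi1_smooth X Ac dp.
have di : differentiable (local_expr c d i) (g 0).
  by rewrite g0; exact: smooth_map_differentiable i_smooth Ac Ad dp dip.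
rewrite /generated_field /differential_mx !derive1E -/g -g0.
transitivity ('D_1 (local_expr c d i \o g) 0).
  apply: near_eq_derive.
  have [odc _ _ _ _] := manifold_chart Ac.
  have : \forall s \near (0 : R), dom c (psi1 (torus_exp (s *: X)) p).
    have dc0 : nbhs (psi1 (torus_exp ((0 : R) *: X)) p) (dom c).
      by apply: open_nbhs_nbhs; split=> //; rewrite scale0r torus_exp0 psi10.
    exact: (orbit_continuous psi1_smooth dc0).
  apply: filterS => s ds.
  by rewrite /g /local_expr /= cK // i_equivariant rhoA scalemxAl.
by rewrite (derive_chain _ dg di) (deriveEjacobian _ di).
Qed.

(** The transpose of A is its adjoint for the pairing, so the component along X
    of the new map is the component of mu along XA, composed with i. Its
    differential is the pullback by i of the contraction of omegaM with (XA)^#,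
    and that is the contraction of omegaN with X^#, since the differential of i
    maps X^# to (XA)^#. *)
Lemma moment_equation_pullback (omegaM : bilinear_field R mM M)
    (omegaN : bilinear_field R kN N) (mu : M -> 'rV[R]_n) (A : 'M[R]_(k, n)) :
  (forall X, rho (torus_exp X) = torus_exp (X *m A)) ->
  pullback_eq (atlas N) (atlas M) i omegaM omegaN ->
  smooth_map (atlas M) (@euclidean_atlas R n) mu ->
  moment_equation psi omegaM mu ->
  moment_equation psi1 omegaN (fun q => mu (i q) *m A^T).
Proof.
move=> rhoA iO smu meq X c p v Ac dp.
have [d Ad dip] := manifold_cover (i p).
have [_ _ _ _ cK] := manifold_chart Ac.
rewrite (iO c d p) // -(generated_field_pushforward X rhoA) // (meq _ d) //.
have di := smooth_map_differentiable i_smooth Ac Ad dp dip.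
pose h y := pairing (mu (param d y)) (X *m A).
have ic : local_expr c d i (coord c p) = coord d (i p).
  by rewrite /local_expr /= cK.
have dh : differentiable h (local_expr c d i (coord c p)).
  rewrite ic; apply: (@differentiable_comp _ _ _ _ (mu \o param d)
    (fun xi => pairing xi (X *m A))); last exact: differentiable_pairing.
  exact: (@smooth_map_differentiable _ _ _ _ _ _ _ _ d (Chart setT id id) _
    smu).
rewrite /differential_mx -(deriveEjacobian _ di) -ic -(derive_chain _ di dh).
apply: near_eq_derive.
have [od _ _ _ dK] := manifold_chart Ad.
have oU : open (i @^-1` dom d).
  by apply: open_comp od => q _; exact: i_smooth.1.
apply: filterS (near_coord (manifold_chart Ac) oU dp dip) => x [_ dx].
by rewrite pairing_mulmx /h /local_expr /= dK.
Qed.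

End Equivariant.

Theorem theorem1 (R : realType) (n k : nat)
  (M : symplectic_manifold R n)
  (psi : torus R n -> M -> M) (mu : M -> 'rV[R]_n)
  (M_toric : symplectic_toric M psi mu)
  (N : symplectic_manifold R k) (N_compact_connected : compact_connected N)
  (psi1 : torus R k -> N -> N) (rho : torus R k -> torus R n) (i : N -> M)
  (N_sub : equivariant_symplectic_submanifold N M psi psi1 rho i) :
  exists mu1 : N -> 'rV[R]_k, symplectic_toric N psi1 mu1.
Proof.
have [_ _ [psi_smooth psi_sympl [mu_smooth mu_moment mu_inv]]] := M_toric.
have [psi1_smooth psi1_eff [rhoD [rho_smooth _ _]]
  [[i_smooth _ _] iO] equi] := N_sub.
have rhoA := torus_hom_exp rhoD rho_smooth.
set A := differential_mx _ _ _ _ in rhoA.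
exists (fun q => mu (i q) *m A^T); split => //; split => //.
  move=> t.
  exact: (pullback_invariant psi1_smooth psi_smooth i_smooth equi iO
    (psi_sympl _)).
split.
- apply: smooth_map_mulmxr; first exact: manifold_chart.
  apply: (smooth_map_comp _ _ _ _ i_smooth mu_smooth).
  + exact: manifold_chart.
  + exact: manifold_chart.
  + exact: manifold_cover.
  + by move=> _ ->; exact: openT.
- exact: (moment_equation_pullback psi1_smooth i_smooth equi rhoA iO mu_smooth).
- by move=> t q; rewrite equi mu_inv.
Qed.
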